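(* Let $(\phi_\infty,\mu_\infty)$ be an equilibrium of the Cahn-Hilliard system, i.e. a periodic solution on $\Omega$ of $$0=\operatorname{div}\big(b(\phi_\infty)\nabla\mu_\infty\big),\qquad \mu_\infty=-\gamma\Delta\phi_\infty+f(\phi_\infty),$$ where $b$ satisfies (B), $f$ satisfies (F), and $\gamma>0$ is known. Then $f'$ is determined uniquely on $R_\infty=\{s=\phi_\infty(x): x\in\Omega\}$ from knowledge of $\phi_\infty$. That is: let $\gamma>0$, let $b_1,b_2$ satisfy (B), let $f_1,f_2$ satisfy (F), and let $\phi_\infty\in H^3(\Omega)$ and $\mu_1,\mu_2\in H^1(\Omega)$ satisfy, for $i=1,2$, $$0=\operatorname{div}\big(b_i(\phi_\infty)\nabla\mu_i\big),\qquad \mu_i=-\gamma\Delta\phi_\infty+f_i(\phi_\infty)$$ (the first equation in the weak sense). Then $f_1'(s)=f_2'(s)$ for all $s\in R_\infty=\{\phi_\infty(x): x\in\Omega\}$.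
   Context: $\Omega$ is the $d$-dimensional torus $\mathbb{T}^d$, $d\in\{1,2,3\}$; all functions on $\Omega$ are periodic. (B): $b:\mathbb{R}\to\mathbb{R}_+$, $b\in C^2(\mathbb{R})$, and there are constants $\beta_1,\beta_2,\beta_3,\beta_4$ with $0<\beta_1\le b(s)\le\beta_2$ for all $s$, $\|b'\|_\infty\le\beta_3$, $\|b''\|_\infty\le\beta_4$. (F): $f=F'$ with $F\in C^4(\mathbb{R})$ such that $F(s)\ge-\kappa$ and $F''(s)\ge-\kappa$ for all $s$ and some $\kappa\ge0$, and $|F^{(k)}(s)|\le p_k+q_k|s|^{4-k}$ for $0\le k\le4$ and all $s$, with constants $p_k,q_k\ge0$. The mobility is not assumed to be known, so the two parameter sets compared may have different mobilities.
   Formalization: The formal theorem additionally assumes that φ_∞ is not almost everywhere constant; for constant φ_∞ the claim fails (e.g. φ_∞ = 0, μ_i = 0, f_1(s) = s, f_2(s) = 2s). *)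

(* Defs.v *)
From HB Require Import structures.
From mathcomp Require Import all_boot all_order all_algebra.
From mathcomp Require Import all_classical all_reals all_analysis.

Set Implicit Arguments.
Unset Strict Implicit.
Unset Printing Implicit Defensive.
Import Order.TTheory GRing.Theory Num.Theory.
Import numFieldNormedType.Exports.

Local Open Scope ring_scope.
Local Open Scope classical_set_scope.

(* A function on the torus T^d = R^d / Z^d is a Z^d-periodic function
   'rV[R]_d -> R, and is integrated over the unit cube. MathComp-Analysis has a
   product sigma-algebra on tuples but none on 'rV[R]_d, so the Lebesgue measure
   of the cube lives on d-tuples and functions are read through [point]. *)

Section UnitCube.
Variable R : realType.

Definition tcons n (p : measurableTypeR R * n.-tuple R) : n.+1.-tuple R :=
  [the n.+1.-tuple R of (p.1 : R) :: p.2].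

Lemma measurable_tcons n :
  measurable_fun [set: measurableTypeR R * n.-tuple R] (@tcons n).
Proof.
apply: (@measurable_cons _ _ _ R fst n snd); last exact: measurable_snd.
exact: (@measurable_fst _ _ (measurableTypeR R) (n.-tuple R)).
Qed.

HB.instance Definition _ n :=
  @isMeasurableFun.Build _ _ (measurableTypeR R * n.-tuple R)%type
    (n.+1.-tuple R) (@tcons n) (@measurable_tcons n).

(* d-fold product of the Lebesgue measure on [0, 1] *)
Fixpoint cube (d : nat) : probability (d.-tuple R) R :=
  match d with
  | 0 => dirac ([tuple] : 0.-tuple R)
  | n.+1 => distribution (uniform_prob (@ltr01 R) \x cube n)%E
              (@tcons n : {mfun _ >-> _})
  end.

Definition point d (t : d.-tuple R) : 'rV[R]_d := \row_i tnth t i.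

End UnitCube.

Section Torus.
Variables (R : realType) (d : nat).
Implicit Types (u v g L psi phi mu : 'rV[R]_d -> R).

Definition unit_vec (i : 'I_d) : 'rV[R]_d := delta_mx 0 i.

Definition periodic u := forall (i : 'I_d) x, u (x + unit_vec i) = u x.

Definition torus_int u : R := \int[cube R d]_t u (point t).

Definition L2 u :=
  periodic u /\ (u \o @point R d) \in Lfun (cube R d) 2%:E.

Definition partial (i : 'I_d) u : 'rV[R]_d -> R := fun x => 'D_(unit_vec i) u x.

Fixpoint Ck_torus (k : nat) u : Prop :=
  continuous u /\
  if k is k'.+1 then
    forall i, (forall x, derivable u x (unit_vec i)) /\
              Ck_torus k' (partial i u)
  else True.

Definition test_function psi := periodic psi /\ forall k, Ck_torus k psi.

Definition weak_partial (i : 'I_d) u g :=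
  [/\ L2 u, L2 g &
      forall psi, test_function psi ->
        torus_int (fun x => u x * partial i psi x) =
        - torus_int (fun x => g x * psi x)].

(* H^k(T^d) *)
Fixpoint sobolev (k : nat) u : Prop :=
  if k is k'.+1 then
    L2 u /\ forall i, exists2 g, weak_partial i u g & sobolev k' g
  else L2 u.

Definition weak_gradient u (G : 'I_d -> 'rV[R]_d -> R) :=
  forall i, weak_partial i u (G i).

Definition weak_laplacian u L :=
  exists2 G, weak_gradient u G &
  exists2 D, forall i, weak_partial i (G i) (D i) &
    forall x, L x = \sum_(i < d) D i x.

(* Weak form of 0 = div (a grad mu), tested against all v in H^1(T^d). *)
Definition weak_div_grad_eq0 (a : 'rV[R]_d -> R) mu :=
  exists2 G, weak_gradient mu G &
    forall v V, sobolev 1 v -> weak_gradient v V ->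
      torus_int (fun x => a x * \sum_(i < d) G i x * V i x) = 0.

Definition equilibrium (b f : R -> R) (gamma : R) phi mu :=
  [/\ sobolev 3 phi, sobolev 1 mu, weak_div_grad_eq0 (b \o phi) mu &
      exists2 L, weak_laplacian phi L &
        {ae cube R d, forall t,
           mu (point t) = - gamma * L (point t) + f (phi (point t))}].

(* {phi(x) : x in T^d}. An element of H^3(T^d), d <= 3, is an a.e. class whose
   point values are those of its unique continuous representative. *)
Definition value_set phi : set R :=
  [set s | exists psi,
     [/\ periodic psi, continuous psi,
         {ae cube R d, forall t, psi (point t) = phi (point t)} &
         range psi s]].

Definition constant_ae phi :=
  exists c : R, {ae cube R d, forall t, phi (point t) = c}.

End Torus.

Section Coefficients.
Variable R : realType.

Definition Ck (k : nat) (g : R -> R) :=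
  (forall j, (j < k)%N -> forall s, derivable g^`(j) s 1) /\
  continuous g^`(k).

Definition mobility (b : R -> R) :=
  Ck 2 b /\
  exists beta1 beta2 beta3 beta4 : R,
    [/\ 0 < beta1,
        forall s, beta1 <= b s <= beta2,
        forall s, `|b^`() s| <= beta3 &
        forall s, `|b^`(2) s| <= beta4].

Definition potential_derivative (f : R -> R) :=
  exists F : R -> R,
    [/\ Ck 4 F, f = F^`(),
        exists2 kappa : R, 0 <= kappa &
          forall s, - kappa <= F s /\ - kappa <= F^`(2) s &
        exists p q : nat -> R,
          forall k, (k <= 4)%N ->
            [/\ 0 <= p k, 0 <= q k &
                forall s, `|F^`(k) s| <= p k + q k * `|s| ^+ (4 - k)]].

End Coefficients.

(* Main.v *)
Require Import Defs.
From mathcomp Require Import all_boot all_order all_algebra.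
From mathcomp Require Import all_classical all_reals all_analysis.
From mathcomp Require Import measurable_realfun.
From mathcomp Require Import ring lra.
Import Order.TTheory GRing.Theory Num.Theory.
Import numFieldNormedType.Exports.

(** The idea is that an equilibrium has a constant chemical potential, whatever
its mobility.  Testing div (b(phi) grad mu) = 0 against mu itself gives
int b(phi) |grad mu|^2 = 0, and b is bounded below by a positive constant, so
grad mu = 0 and mu is a.e. a constant ([weak_div_grad_constant_ae]).  Hence
mu_1 = c_1 and mu_2 = c_2, and subtracting the two relations
mu_i = - gamma Delta phi + f_i(phi) leaves f_1(phi) - f_2(phi) = c_1 - c_2 a.e.:
the Laplacian cancels since weak derivatives are a.e. unique
([weak_laplacian_ae_unique]).  For a continuous periodic representative psi of
phi this identity holds at every point ([continuous_ae_cst]), so f_1 - f_2 is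
constant on the range of psi.  As phi is not constant, that range contains a
nondegenerate segment issued from each of its points ([segment_in_range], the
intermediate value theorem along a line), and the derivative of f_1 - f_2
vanishes there ([derive1_eq0_segment]).

Two facts about L^2 functions on the torus carry the argument: a function
orthogonal to every test function is null, and a function whose weak gradient
is null is constant.  Both only need trigonometric polynomials as test
functions, taken as the real span of the waves cos (2 pi k.x + theta); these
waves are, up to scalars, closed under differentiation and, by the product
formula for cosines, their span is an algebra.

For the first fact ([trig_orthogonal_ae0]), apply to a trigonometric polynomial
q with values in [0, 1] the map q |-> (1 - q^(2n))^(n 4^n).  It tends to 1 where
q < 1/2 and to 0 where q >= 1/2, so the indicator of {q < 1/2} is a bounded
pointwise limit of trigonometric polynomials.  Half-spaces {t_i < a} have this
form in the open cube, and products give their finite intersections.  By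
dominated convergence and Dynkin's pi-lambda theorem the function integrates
to zero over every measurable set.

For the second ([constant_ae_weak_gradient0]), every wave with frequency k <> 0
is a derivative of a wave and has mean zero ([integral_wave]); so u minus its
mean is orthogonal to all waves, and the first fact applies. *)

Set Implicit Arguments.
Unset Strict Implicit.
Unset Printing Implicit Defensive.

Local Open Scope ring_scope.
Local Open Scope classical_set_scope.

(** * Lebesgue measure of boxes in the unit cube *)

Section CubeMeasure.
Variable R : realType.
Implicit Types (d : nat).

Lemma uniform01_itvoo (a b : R) : 0 <= a -> a <= b -> b <= 1 ->
  uniform_prob (@ltr01 R) `]a, b[%classic = (b - a)%:E.
Proof.
move=> a0 ab b1.
have := @integral_uniform R 0 1 (@ltr01 R) (fun x => (\1_(`]a, b[%classic) x)%:E).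
have mab : measurable (`]a, b[%classic : set (measurableTypeR R)).
  exact: measurable_itv.
rewrite integral_indic// setIT => ->; last 2 first.
- by apply/measurable_EFinP; exact: measurable_indic.
- by move=> x; rewrite lee_fin.
rewrite subr0 invr1 mul1e integral_indic//=.
rewrite setIidl; last first.
  move=> x /=; rewrite !in_itv/= => /andP[ax xb].
  by rewrite (le_trans a0 (ltW ax)) (le_trans (ltW xb)).
rewrite lebesgue_measure_itv/= lte_fin; case: ltP => // ba.
by rewrite (_ : b = a) ?subrr//; apply/eqP; rewrite eq_le ba ab.
Qed.

Lemma measurable_box d (J : 'I_d -> set R) : (forall i, measurable (J i)) ->
  measurable [set t : d.-tuple R | forall i, J i (tnth t i)].
Proof.
move=> mJ.
rewrite (_ : [set _ | _] =
    \bigcap_(i in [set: 'I_d]) ((fun t => tnth t i) @^-1` J i)); last first.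
  by apply/seteqP; split=> t /= Jt i => [_|]; exact: Jt.
apply: fin_bigcap_measurable => // i _.
by rewrite -[X in measurable X]setTI; exact: measurable_tnth.
Qed.

(** The cube carries a product measure; its recursive definition peels off the
first coordinate, whence the induction. *)
Lemma cube_box d (J : 'I_d -> set R) : (forall i, measurable (J i)) ->
  cube R d [set t | forall i, J i (tnth t i)] =
  (\prod_(i < d) uniform_prob (@ltr01 R) (J i))%E.
Proof.
elim: d J => [|d IH] J mJ.
  by rewrite big_ord0 /= diracE mem_set// => -[].
rewrite big_ord_recl/= /distribution /pushforward.
rewrite (_ : _ @^-1` _ = J ord0 `*`
    [set t : d.-tuple R | forall i, J (lift ord0 i) (tnth t i)]).
  rewrite product_measure1E; [|exact: mJ|].
    by rewrite /= (IH (fun i => J (lift ord0 i))).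
  by apply: (@measurable_box d (fun i => J (lift ord0 i))) => i; exact: mJ.
apply/seteqP; split=> [[x t]/= H|[x t]/= [H0 H] i].
  split=> [|i]; first by have := H ord0; rewrite tnth0.
  by have := H (lift ord0 i); rewrite tnthS.
case: (unliftP ord0 i) => [j|] ->; first by rewrite tnthS; exact: H.
by rewrite tnth0.
Qed.

(** Periodic functions do not separate opposite faces of the closed cube; the
separation arguments are carried out in its interior, which has full measure. *)
Definition open_cube d : set (d.-tuple R) :=
  [set t | forall i, 0 < tnth t i < 1].

Lemma ae_open_cube d : {ae cube R d, forall t, open_cube t}.
Proof.
have DE : @open_cube d =
    [set t : d.-tuple R | forall i, (`]0, 1[%classic : set R) (tnth t i)].
  by apply/seteqP; split=> t /= Dt i; have := Dt i; rewrite ?in_itv.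
have mI (i : 'I_d) : measurable (`]0, 1[%classic : set R).
  exact: measurable_itv.
have mD : measurable (@open_cube d) by rewrite DE; exact: measurable_box mI.
exists (~` @open_cube d); split => //; first exact: measurableC.
rewrite [LHS]probability_setC// DE (cube_box mI) big1 ?subee// => i _.
by rewrite uniform01_itvoo// subr0.
Qed.

End CubeMeasure.

(** * Trigonometric polynomials *)

Section TrigonometricPolynomials.
Variables (R : realType) (d : nat).
Implicit Types (k l : 'I_d -> int) (a th : R) (u v : 'rV[R]_d -> R).

(** A phase [th] besides the frequency [k] avoids treating sines separately: the
sine is the cosine shifted by a quarter period, and so is the derivative. *)
Definition phase k th (x : 'rV[R]_d) : R :=
  pi *+ 2 * (\sum_(i < d) (k i)%:~R * x 0 i) + th.

Definition wave k th x : R := cos (phase k th x).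

Inductive trig_poly : ('rV[R]_d -> R) -> Prop :=
| trig_wave k th : trig_poly (wave k th)
| trig_add u v : trig_poly u -> trig_poly v -> trig_poly (fun x => u x + v x)
| trig_scale a u : trig_poly u -> trig_poly (fun x => a * u x).

Lemma wave0 th x : wave (fun=> 0) th x = cos th.
Proof.
by rewrite /wave /phase big1 ?mulr0 ?add0r// => i _; rewrite mul0r.
Qed.

Lemma trig_cst a : trig_poly (fun=> a).
Proof.
rewrite (_ : (fun=> a) = (fun x => a * wave (fun=> 0) 0 x)).
  exact/trig_scale/trig_wave.
by apply/funext => x; rewrite wave0 cos0 mulr1.
Qed.

(** The product formula for cosines: the reason why the span of the waves is an
algebra. *)
Lemma waveM k th l th' x : wave k th x * wave l th' x =
  2^-1 * (wave (fun i => k i + l i) (th + th') x +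
          wave (fun i => k i - l i) (th - th') x).
Proof.
rewrite /wave; set A := phase k th x; set B := phase l th' x.
have -> : phase (fun i => k i + l i) (th + th') x = A + B.
  rewrite /A /B /phase.
  under eq_bigr do rewrite rmorphD/= mulrDl.
  by rewrite big_split/=; ring.
have -> : phase (fun i => k i - l i) (th - th') x = A - B.
  rewrite /A /B /phase.
  under eq_bigr do rewrite rmorphB/= mulrBl.
  by rewrite big_split/= sumrN; ring.
by rewrite cosD cosB; field.
Qed.

Lemma trigM u v : trig_poly u -> trig_poly v -> trig_poly (fun x => u x * v x).
Proof.
move=> Hu Hv; elim: Hu => [k th|u1 u2 _ H1 _ H2|a u1 _ H1].
- elim: Hv => [l th'|v1 v2 _ H1 _ H2|a v1 _ H1].
  + rewrite (_ : (fun _ => _) = (fun x => 2^-1 *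
        (wave (fun i => k i + l i) (th + th') x +
         wave (fun i => k i - l i) (th - th') x))).
      by apply: trig_scale; apply: trig_add; exact: trig_wave.
    by apply/funext => x; rewrite waveM.
  + by under eq_fun do rewrite mulrDr; exact: trig_add.
  + by under eq_fun do rewrite mulrCA; exact: trig_scale.
- by under eq_fun do rewrite mulrDl; exact: trig_add.
- by under eq_fun do rewrite -mulrA; exact: trig_scale.
Qed.

Lemma trigX u n : trig_poly u -> trig_poly (fun x => u x ^+ n).
Proof.
move=> Hu; elim: n => [|n IH].
  by under eq_fun do rewrite expr0; exact: trig_cst.
by under eq_fun do rewrite exprS; exact: trigM.
Qed.

Lemma phase_shift k th x i :
  phase k th (x + unit_vec R i) = phase k th x + pi *+ 2 *~ k i.
Proof.
rewrite /phase.
under eq_bigr do rewrite mxE mulrDr.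
rewrite big_split/= [X in _ * (_ + X)](bigD1 i)//= [X in _ * (_ + (_ + X))]big1; last first.
  by move=> j ji; rewrite mxE (negbTE ji) andbF mulr0.
rewrite addr0 mxE !eqxx mulr1 mulrDr addrAC; congr (_ + _ + _).
by rewrite mulrzr.
Qed.

Lemma cosDz (x : R) (m : int) : cos (x + pi *+ 2 *~ m) = cos x.
Proof.
case: m => n; last first.
  rewrite NegzE mulrNz -[in RHS](addrNK (pi *+ 2 *~ n.+1) x).
  set y := x - _; rewrite -pmulrn.
  by elim: n.+1 => [|m IH]; rewrite ?addr0// mulrSr addrA cosD2pi.
rewrite -pmulrn.
by elim: n => [|m IH]; rewrite ?addr0// mulrSr addrA cosD2pi.
Qed.

Lemma trig_periodic u : trig_poly u -> Defs.periodic u.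
Proof.
elim=> [k th|u1 u2 _ H1 _ H2|a u1 _ H1] i x; rewrite ?H1 ?H2//.
by rewrite /wave phase_shift cosDz.
Qed.

Lemma trig_continuous u : trig_poly u -> continuous u.
Proof.
elim=> [k th|u1 u2 _ H1 _ H2|a u1 _ H1] x.
- apply: continuous_comp; last exact: continuous_cos.
  have C i : continuous (fun y : 'rV[R]_d => (k i)%:~R * y 0 i).
    by move=> y; apply: continuousM; [exact: cst_continuous|exact: coord_continuous].
  rewrite /phase; apply: continuousD; last exact: cst_continuous.
  apply: continuousM; first exact: cst_continuous.
  apply: (continuous_big _ (fun i _ => C i)) => y; exact: add_continuous.
- by apply: continuousD; [exact: H1|exact: H2].
- by apply: continuousM; [exact: cst_continuous|exact: H1].
Qed.

(** Along the line through [x] in direction e_i, the wave is the cosine of an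
affine function of slope 2 pi k_i. *)
Lemma is_derive_wave k th i x : is_derive x (unit_vec R i) (wave k th)
  (pi *+ 2 * (k i)%:~R * wave k (th + pi / 2) x).
Proof.
pose c := pi *+ 2 * (k i)%:~R : R.
have E : (fun h : R => wave k th (h *: unit_vec R i + x)) =
    cos \o (fun h => h * c + phase k th x).
  apply/funext => h /=; rewrite /wave /phase; congr cos.
  under eq_bigr do rewrite !mxE mulrDr.
  rewrite big_split/= (bigD1 i)//= [X in _ * (_ + X + _)]big1; last first.
    by move=> j ji; rewrite (negbTE ji) mulr0 mulr0.
  by rewrite eqxx/= mulr1 /c; ring.
have D : is_derive (0 : R) (1 : R) (cos \o (fun h => h * c + phase k th x))
    (c * wave k (th + pi / 2) x).
  have -> : c * wave k (th + pi / 2) x = - sin (0 * c + phase k th x) * c.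
    rewrite mul0r add0r mulrC; congr (_ * _).
    by rewrite /wave /phase addrA cosDpihalf.
  apply: is_derive1_comp.
  have -> : (fun h => h * c + phase k th x) = c *: id + cst (phase k th x).
    by apply/funext => h; rewrite mulrC.
  by apply: is_derive_eq; rewrite addr0 [_ *: _]mulr1.
case: D => D1 D2.
split; first by apply/derivable1P; rewrite E.
rewrite -D2 -E /derive/=.
set g1 := fun h => h^-1 *: _; set g2 := fun h => h^-1 *: _.
suff -> : g1 = g2 by [].
apply/funext => h; rewrite /g1 /g2 /=.
by rewrite addr0 scale0r add0r [_%:A]mulr1.
Qed.

Lemma trig_derive u : trig_poly u -> forall i,
  (forall x, derivable u x (unit_vec R i)) /\ trig_poly (partial i u).
Proof.
elim=> [k th|u1 u2 _ H1 _ H2|a u1 _ H1] i.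
- have D := is_derive_wave k th i.
  split; first by move=> x; have [] := D x.
  rewrite (_ : partial i _ =
    fun x => pi *+ 2 * (k i)%:~R * wave k (th + pi / 2) x).
    exact/trig_scale/trig_wave.
  by apply/funext => x; have [_] := D x.
- have [D1 T1] := H1 i; have [D2 T2] := H2 i.
  split=> [x|]; first exact: derivableD.
  rewrite (_ : partial i _ = fun x => partial i u1 x + partial i u2 x).
    exact: trig_add.
  by apply/funext => x; rewrite /partial deriveD.
- have [D1 T1] := H1 i.
  split=> [x|]; first exact: derivableZ.
  rewrite (_ : partial i _ = fun x => a * partial i u1 x).
    exact: trig_scale.
  by apply/funext => x; rewrite /partial deriveZ.
Qed.

(** By induction on the order of differentiation, since partial derivatives of
trigonometric polynomials are trigonometric polynomials. *)
Lemma trig_test u : trig_poly u -> test_function u.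
Proof.
move=> Hu; split; first exact: trig_periodic.
move=> k; elim: k u Hu => [|k IH] u Hu /=; split => //.
- exact: trig_continuous.
- exact: trig_continuous.
- by move=> i; have [D T] := trig_derive Hu i; split => //; exact: IH.
Qed.

Lemma trig_bounded u : trig_poly u -> exists M, forall x, `|u x| <= M.
Proof.
elim=> [k th|u1 u2 _ [M1 H1] _ [M2 H2]|a u1 _ [M H]].
- by exists 1 => x; rewrite /wave ler_norml cos_geN1 cos_le1.
- exists (M1 + M2) => x; rewrite (le_trans (ler_normD _ _))//.
  exact: lerD.
- by exists (`|a| * M) => x; rewrite normrM ler_wpM2l.
Qed.

Lemma measurable_trig u : trig_poly u -> 
  measurable_fun [set: d.-tuple R] (fun t => u (Defs.point t)).
Proof.
elim=> [k th|u1 u2 _ H1 _ H2|a u1 _ H1].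
- apply: (measurableT_comp (f := cos)).
    by apply: continuous_measurable_fun; exact: continuous_cos.
  apply: measurable_funD => //; apply: measurable_funM => //.
  apply: measurable_sum => i; apply: measurable_funM => //=.
  under eq_fun do rewrite mxE.
  exact: measurable_tnth.
- exact: measurable_funD.
- by apply: measurable_funM => //.
Qed.

End TrigonometricPolynomials.

(** * Mean value of the waves *)

Section MeanOfWaves.
Variable R : realType.

Lemma sinDz (x : R) (m : int) : sin (x + pi *+ 2 *~ m) = sin x.
Proof. by rewrite -!cosBpihalf addrAC cosDz. Qed.

(** Adding 1 makes the integrand nonnegative, so that the multidimensional case
below follows from Tonelli's theorem with no integrability condition. *)
Lemma integral_uniform_wave (m : int) (th : R) : m != 0 ->
  (\int[uniform_prob (@ltr01 R)]_x (1 + cos (pi *+ 2 * m%:~R * x + th))%:E = 1)%E.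
Proof.
move=> m0; set c := pi *+ 2 * m%:~R : R.
have c0 : c != 0.
  by rewrite mulf_neq0 ?intr_eq0// mulrn_eq0/= gt_eqF// pi_gt0.
pose f (x : R) := 1 + cos (c * x + th).
have cf : continuous f.
  move=> x; apply: continuousD; first exact: cst_continuous.
  apply: continuous_comp; last exact: continuous_cos.
  apply: continuousD; last exact: cst_continuous.
  by apply: continuousM => //; exact: cst_continuous.
pose F := (id : R -> R) + c^-1 *: (sin \o (c *: id + cst th)) : R -> R.
have dF x : is_derive x (1 : R) F (f x).
  have D : is_derive x (1 : R) (sin \o (c *: id + cst th) : R -> R)
      (cos (c * x + th) * c).
    apply: is_derive1_comp; apply: is_derive_eq.
    by rewrite addr0 [_ *: _]mulr1.
  apply: is_derive_eq; rewrite /f; congr (_ + _).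
  by rewrite [_ *: _]mulrCA mulVf// mulr1.
have cF : continuous F.
  move=> x; apply/differentiable_continuous/derivable1_diffP.
  by have [] := dF x.
rewrite integral_uniform; last 2 first.
- by apply/measurable_EFinP; exact: continuous_measurable_fun.
- by move=> x; rewrite lee_fin -lerBlDl sub0r cos_geN1.
rewrite subr0 invr1 mul1e.
rewrite (@continuous_FTC2 R f F)//.
- have FE x : F x = x + c^-1 * sin (c * x + th) by [].
  rewrite -EFinB !FE mulr0 add0r mulr1; congr EFin.
  have -> : sin (c + th) = sin th :> R by rewrite addrC /c mulrzr sinDz.
  by rewrite add0r addrK.
- exact: continuous_subspaceT.
- split.
  + by move=> x _; have [] := dF x.
  + exact/cvg_at_right_filter/cF.
  + exact/cvg_at_left_filter/cF.
- by move=> x _; have [_] := dF x; rewrite derive1E.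
Qed.

Lemma wave_tcons d (k : 'I_d.+1 -> int) th (x : R) (t : d.-tuple R) :
  wave k th (Defs.point (tcons (x, t))) =
  wave (fun i => k (lift ord0 i)) (th + pi *+ 2 * (k ord0)%:~R * x)
    (Defs.point t).
Proof.
rewrite /wave /phase big_ord_recl/= mxE tnth0; congr cos.
under eq_bigr do rewrite mxE tnthS.
under [in RHS]eq_bigr do rewrite mxE.
by rewrite /=; ring.
Qed.

Lemma wave_ge (d : nat) k th (x : 'rV[R]_d) : 0 <= 1 + wave k th x.
Proof. by rewrite -lerBlDl sub0r cos_geN1. Qed.

(** Induction on the dimension, integrating the first coordinate last.  If the
remaining frequencies are not all zero, the inner integral is already 1;
otherwise the wave depends on the first coordinate only. *)
Lemma integral_wave d (k : 'I_d -> int) th i : k i != 0 ->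
  (\int[cube R d]_t (1 + wave k th (Defs.point t))%:E = 1)%E.
Proof.
elim: d k th i => [|d IH] k th i ki; first by case: i ki.
have mw : measurable_fun [set: d.+1.-tuple R]
    (fun t => (1 + wave k th (Defs.point t))%:E).
  apply/measurable_EFinP; apply: measurable_funD => //.
  by apply: measurable_trig; exact: trig_wave.
rewrite /= ge0_integral_pushforward//; last first.
  by move=> t _; rewrite lee_fin wave_ge.
rewrite preimage_setT fubini_tonelli1; last 2 first.
- by apply: measurableT_comp mw _; exact: measurable_tcons.
- by move=> z; rewrite lee_fin wave_ge.
rewrite /fubini_F /=.
under eq_integral => x _ do
  under eq_integral => t _ do rewrite wave_tcons.
have [k'0|] := pselect (forall j, k (lift ord0 j) = 0); last first.
  move=> /existsNP[j /eqP kj].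
  under eq_integral => x _ do rewrite (IH _ _ j)//.
  by rewrite integral_cst// mul1e; exact: probability_setT.
have k0 : k ord0 != 0.
  by case: (unliftP ord0 i) ki => [j ->|-> //]; rewrite k'0 eqxx.
rewrite -[RHS](integral_uniform_wave th k0).
apply: eq_integral => x _.
under eq_integral => t _.
  rewrite (_ : (fun j => k (lift ord0 j)) = (fun=> 0)) ?wave0; last exact/funext.
  over.
rewrite integral_cst// [X in (_ * X)%E](probability_setT (cube R d)) mule1.
by rewrite [_ + th]addrC.
Qed.

End MeanOfWaves.

(** * Polynomial approximation of a step function *)

Section Threshold.
Variable R : realType.
Implicit Types (q x r : R).

Lemma bernoulli_ineq x n : -1 <= x -> 1 + n%:R * x <= (1 + x) ^+ n.
Proof.
move=> x1; elim: n => [|n IH]; first by rewrite mul0r addr0 expr0.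
rewrite exprS; apply: (@le_trans _ _ ((1 + x) * (1 + n%:R * x))); last first.
  by rewrite ler_wpM2l// -lerBlDl sub0r.
have -> : (1 + x) * (1 + n%:R * x) = 1 + n.+1%:R * x + n%:R * x ^+ 2.
  by rewrite -natr1; ring.
by rewrite lerDl mulr_ge0// sqr_ge0.
Qed.

(** Since r^n <= r^k for k < n, n r^n is at most 1 + r + ... + r^(n-1). *)
Lemma mulr_natX_bound r n : 0 <= r <= 1 -> n%:R * r ^+ n * (1 - r) <= 1 - r ^+ n.
Proof.
move=> /andP[r0 r1]; elim: n => [|n IH]; first by rewrite !mul0r expr0 subrr.
have X1 : r ^+ n <= 1 by rewrite exprn_ile1.
have X0 : 0 <= r ^+ n by rewrite exprn_ge0.
have rX1 : r * r ^+ n <= 1 by rewrite mulr_ile1.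
have : 0 <= (1 - r) * (1 - r * r ^+ n) by rewrite mulr_ge0// subr_ge0.
have := ler_wpM2l r0 IH; rewrite exprS -natr1; lra.
Qed.

(** The exponent 2n lets one factor r^n absorb n, by the previous bound, while
the other tends to 0. *)
Lemma cvg_mulr_natX r : 0 <= r < 1 -> n%:R * r ^+ (n * 2) @[n --> \oo] --> 0.
Proof.
move=> /andP[r0 r1].
have r1' : 0 < 1 - r by rewrite subr_gt0.
have cX : (1 - r)^-1 * r ^+ n @[n --> \oo] --> 0.
  rewrite -(mulr0 (1 - r)^-1); apply: cvgM; first exact: cvg_cst.
  by apply: cvg_expr; rewrite ger0_norm.
apply: squeeze_cvgr (cvg_cst 0) cX; apply: nearW => n.
rewrite mulr_ge0 ?exprn_ge0//= muln2 -addnn exprD mulrA ler_wpM2r ?exprn_ge0//.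
rewrite -[leRHS]mul1r ler_pdivlMr// (le_trans (mulr_natX_bound _ _))//.
  by rewrite r0 ltW.
by rewrite lerBlDl lerDr exprn_ge0.
Qed.

(** The factor n in front of 2^(2n) makes the limit 0 also at the threshold 1/2,
where the exponent 2^(2n) alone would give 1/e. *)
Definition step_exponent n := (n * 2 ^ (n * 2))%N.

Definition step_approx n q : R := (1 - q ^+ (n * 2)) ^+ step_exponent n.

Lemma step_approx_ge0_le1 n q : 0 <= q <= 1 -> 0 <= step_approx n q <= 1.
Proof.
move=> /andP[q0 q1].
have X1 : q ^+ (n * 2) <= 1 by rewrite exprn_ile1.
have X0 : 0 <= q ^+ (n * 2) by rewrite exprn_ge0.
rewrite exprn_ge0 ?subr_ge0//= exprn_ile1// ?subr_ge0//.
by rewrite lerBlDl lerDr.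
Qed.

(** Bernoulli's inequality bounds the step below by 1 - n (2q)^(2n). *)
Lemma step_approx_lt q : 0 <= q -> q < 2^-1 ->
  step_approx n q @[n --> \oo] --> (1 : R).
Proof.
move=> q0 q2.
have q1 : q <= 1 by lra.
have c : 1 - n%:R * (2 * q) ^+ (n * 2) @[n --> \oo] --> (1 : R).
  rewrite -[X in _ --> X]subr0; apply: cvgB; first exact: cvg_cst.
  by apply: cvg_mulr_natX; apply/andP; split; lra.
apply: squeeze_cvgr c (cvg_cst (1 : R)); apply: nearW => n.
have /andP[_ ->] : 0 <= step_approx n q <= 1.
  by apply: step_approx_ge0_le1; rewrite q0.
have X1 : q ^+ (n * 2) <= 1 by rewrite exprn_ile1.
rewrite andbT /step_approx; apply: le_trans (bernoulli_ineq _ _); last first.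
  by rewrite lerN2.
by rewrite natrM natrX exprMn mulrN mulrA.
Qed.

(** With x = q^(2n) >= 4^-n and N the exponent, (1 - x)^N (1 + x)^N <= 1 and
Bernoulli's inequality give (1 - x)^N <= 1 / (1 + N x) <= 1 / (n + 1). *)
Lemma step_approx_ge q : 2^-1 <= q -> q <= 1 ->
  step_approx n q @[n --> \oo] --> (0 : R).
Proof.
move=> q2 q1; have q0 : 0 <= q by lra.
apply: squeeze_cvgr (cvg_cst (0 : R)) cvg_harmonic; apply: nearW => n.
have /andP[-> _] : 0 <= step_approx n q <= 1.
  by apply: step_approx_ge0_le1; rewrite q0.
rewrite /step_approx /harmonic; set x := q ^+ (n * 2); set N := step_exponent n.
have X1 : x <= 1 by rewrite exprn_ile1.
have X0 : 0 <= x by rewrite exprn_ge0.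
rewrite /= -[leRHS]mul1r ler_pdivlMr//.
apply: (@le_trans _ _ ((1 - x) ^+ N * (1 + x) ^+ N)).
  rewrite ler_wpM2l ?exprn_ge0 ?subr_ge0//.
  apply: le_trans (bernoulli_ineq _ _); last by rewrite (le_trans _ X0)// lerN10.
  rewrite -natr1 addrC lerD2l /N natrM natrX -mulrA ler_peMr//.
  by rewrite -exprMn exprn_ege1//; lra.
by rewrite -exprMn exprn_ile1//; nra.
Qed.

End Threshold.

(** * The fundamental lemma of the calculus of variations *)

Section TrigonometricApproximation.
Variables (R : realType) (d : nat).
Implicit Types (A B : set (d.-tuple R)) (u : 'rV[R]_d -> R).

Local Notation pt := (@Defs.point R d).

(** The uniform bound is what dominated convergence needs, and it makes the
notion stable under intersection. *)
Definition trig_approximable A := measurable A /\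
  exists p : nat -> 'rV[R]_d -> R,
    [/\ forall n, trig_poly (p n),
        forall n x, `|p n x| <= 1 &
        forall t, open_cube t -> p n (pt t) @[n --> \oo] --> (\1_A t : R)].

Lemma trig_approximableI A B :
  trig_approximable A -> trig_approximable B -> trig_approximable (A `&` B).
Proof.
move=> [mA [p [Tp p1 pA]]] [mB [q [Tq q1 qB]]]; split; first exact: measurableI.
exists (fun n x => p n x * q n x); split=> [n|n x|t Dt].
- exact: trigM.
- by rewrite normrM mulr_ile1.
- by rewrite indicI; apply: cvgM; [exact: pA|exact: qB].
Qed.

(** Rescaling turns the sign condition on [u] into the threshold 1/2 for a
function with values in [0, 1], to which the step functions apply. *)
Lemma trig_approximable_lt u A : measurable A -> trig_poly u ->
  (forall x, `|u x| <= 2) ->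
  (forall t, open_cube t -> A t <-> u (pt t) < 0) -> trig_approximable A.
Proof.
move=> mA Tu u2 Au; split => //.
pose q x : R := 2^-1 + 4^-1 * u x.
have q01 x : 0 <= q x <= 1.
  by have := u2 x; rewrite ler_norml => /andP[? ?]; rewrite /q; apply/andP; lra.
exists (fun n x => step_approx n (q x)); split=> [n|n x|t Dt].
- apply: trigX; apply: (@trig_add _ _ (fun=> 1)); first exact: trig_cst.
  under eq_fun do rewrite -mulN1r.
  apply: trig_scale; apply: trigX; apply: (@trig_add _ _ (fun=> 2^-1)).
    exact: trig_cst.
  exact: trig_scale.
- have /andP[s0 s1] := step_approx_ge0_le1 n (q01 x).
  by rewrite ger0_norm.
- have /andP[q0 q1] := q01 (pt t).
  rewrite indicE; have [At|nAt] := boolP (t \in A).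
    apply: step_approx_lt => //.
    by move: At; rewrite inE => /(Au _ Dt).1 ?; rewrite /q; lra.
  apply: step_approx_ge => //.
  have : 0 <= u (pt t).
    by rewrite leNgt; apply: contra nAt => ?; rewrite inE; exact/Au.
  by rewrite /q; lra.
Qed.

Lemma trig_approximable_setT : trig_approximable setT.
Proof.
apply: (@trig_approximable_lt (fun=> -1)) => //; first exact: trig_cst.
by move=> x; rewrite normrN1; lra.
Qed.

(** The difference of cosines is - 2 sin (pi x) sin (pi (a - x)): a trigonometric
polynomial in x that changes sign in the unit interval only at a. *)
Lemma lt_cos_sign (a x : R) : 0 < a < 1 -> 0 < x < 1 ->
  (x < a) = (cos (pi * a) - cos (pi *+ 2 * x - pi * a) < 0).
Proof.
move=> /andP[a0 a1] /andP[x0 x1].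
have pi0 := pi_gt0 R.
have -> : cos (pi * a) - cos (pi *+ 2 * x - pi * a) =
    - (2 * (sin (pi * x) * sin (pi * (a - x)))).
  have -> : pi * a = pi * x + pi * (a - x) by ring.
  have -> : pi *+ 2 * x - (pi * x + pi * (a - x)) = pi * x - pi * (a - x).
    by ring.
  by rewrite cosD cosB; ring.
have sx : 0 < sin (pi * x).
  by apply: sin_gt0_pi; rewrite mulr_gt0//= -[ltRHS]mulr1 ltr_pM2l.
rewrite oppr_lt0 pmulr_rgt0// pmulr_rgt0//.
have [xa|ax] := ltP x a.
  apply/esym; apply: sin_gt0_pi; apply/andP; split.
    by rewrite mulr_gt0// subr_gt0.
  by rewrite -[ltRHS]mulr1 ltr_pM2l//; lra.
apply/esym/negbTE; rewrite -leNgt -oppr_ge0 -sinN -mulrN opprB.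
apply: sin_ge0_pi; apply/andP; split.
  by rewrite mulr_ge0 ?subr_ge0// ltW.
by rewrite -[leRHS]mulr1 ler_pM2l//; lra.
Qed.

Lemma trig_approximable_coord (i : 'I_d) (a : R) :
  trig_approximable [set t | tnth t i < a].
Proof.
have mA (b : R) : measurable [set t : d.-tuple R | tnth t i < b].
  rewrite (_ : [set _ | _] = (fun t => tnth t i) @^-1` `]-oo, b[%classic).
    have mI : measurable (`]-oo, b[%classic : set R) by exact: measurable_itv.
    by rewrite -[X in measurable X]setTI; exact: measurable_tnth.
  by apply/seteqP; split=> t /=; rewrite in_itv.
have [a0|a0] := leP a 0.
  apply: (@trig_approximable_lt (fun=> 0)) => //; first exact: trig_cst.
    by move=> x; rewrite normr0.
  move=> t /(_ i)/andP[t0 _]; rewrite ltxx; split => //=.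
  by rewrite ltNge (le_trans a0 (ltW t0)).
have [a1|a1] := leP 1 a.
  apply: (@trig_approximable_lt (fun=> -1)) => //; first exact: trig_cst.
    by move=> x; rewrite normrN1; lra.
  move=> t /(_ i)/andP[_ t1]; rewrite ltrN10; split => //= _.
  exact: lt_le_trans t1 a1.
pose k j : int := (j == i)%:Z.
have wE t : wave k (- (pi * a)) (pt t) = cos (pi *+ 2 * tnth t i - pi * a).
  rewrite /wave /phase (bigD1 i)//= big1 ?addr0; last first.
    by move=> j /negbTE ji; rewrite /k ji mul0r.
  by rewrite /k eqxx mul1r mxE.
apply: (@trig_approximable_lt
    (fun x => cos (pi * a) + -1 * wave k (- (pi * a)) x)) => //.
- apply: (@trig_add _ _ (fun=> cos (pi * a))); first exact: trig_cst.
  exact/trig_scale/trig_wave.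
- move=> x; rewrite mulN1r (le_trans (ler_normB _ _))// /wave.
  by rewrite (_ : 2 = 1 + 1)// lerD// ler_norml cos_geN1 cos_le1.
- move=> t Dt; rewrite mulN1r wE -lt_cos_sign//; by rewrite a0.
Qed.

(** The product sigma-algebra is generated by the half-spaces t_i < a. *)
Lemma measurable_trig_approximable :
  @measurable _ (d.-tuple R) = <<s trig_approximable >>.
Proof.
apply/seteqP; split; last first.
  by apply: smallest_sub => [|A []//]; exact: sigma_algebra_measurable.
apply: smallest_sub; first exact: smallest_sigma_algebra.
rewrite -bigcup_seq; apply: bigcup_sub => i _.
have -> : @measurable _ R = (@RGenInftyO.G R).-sigma.-measurable.
  by rewrite -RGenInftyO.measurableE.
rewrite -g_sigma_preimageE.
apply: smallest_sub; first exact: smallest_sigma_algebra.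
move=> _ [_ [a ->] <-]; apply: sub_sigma_algebra.
rewrite (_ : _ `&` _ = [set t : d.-tuple R | tnth t i < a]).
  exact: trig_approximable_coord.
by apply/seteqP; split=> t /=; rewrite in_itv/=; tauto.
Qed.

Section fundamental_lemma.
Local Open Scope ereal_scope.
Variable g : d.-tuple R -> R.
Hypothesis ig : (cube R d).-integrable setT (EFin \o g).
Hypothesis g0 : forall u, trig_poly u ->
  \int[cube R d]_t (g t * u (pt t))%:E = 0.

Lemma integral_approximable0 A : trig_approximable A ->
  \int[cube R d]_(t in A) (g t)%:E = 0.
Proof.
move=> [mA [p [Tp p1 pA]]].
have mg : measurable_fun setT g by apply/measurable_EFinP; case/integrableP: ig.
have [|||||_ _] := @dominated_convergence _ _ _ (cube R d) setT measurableT
    (fun n t => (g t * p n (pt t))%:E) (fun t => (g t * \1_A t)%:E)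
    (fun t => `|(g t)%:E|).
- move=> n; apply/measurable_EFinP; apply: measurable_funM => //.
  exact: measurable_trig.
- by apply/measurable_EFinP; apply: measurable_funM.
- apply: filterS (@ae_open_cube R d) => t Dt _; apply: cvg_EFin.
    exact: nearW.
  by apply: cvgM; [exact: cvg_cst|exact: pA].
- exact: integrable_abse.
- apply: aeW => t n _; rewrite lee_fin normrM ler_piMr//.
under eq_fun do rewrite g0//.
move=> /cvg_lim; rewrite lim_cst// => /(_ (@ereal_hausdorff R)) ->.
rewrite [LHS]integral_mkcond; apply: eq_integral => t _.
by rewrite patchE indicE; case: ifPn => _; rewrite ?mulr1 ?mulr0.
Qed.

(** Fundamental lemma of the calculus of variations, with trigonometric
polynomials as test functions. *)
Lemma trig_orthogonal_ae0 : {ae cube R d, forall t, g t = 0%R}.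
Proof.
have H A : measurable A -> \int[cube R d]_(t in A) (g t)%:E = 0.
  move=> mA.
  apply: (@dynkin_induction _ _ trig_approximable
    (fun A => \int[cube R d]_(t in A) (g t)%:E = 0)).
  - exact: measurable_trig_approximable.
  - exact: trig_approximableI.
  - exact/integral_approximable0/trig_approximable_setT.
  - exact: integral_approximable0.
  - move=> B mB B0.
    have := integral_approximable0 trig_approximable_setT.
    rewrite -(setUv B) integral_setU//; first by rewrite B0 add0e.
    + exact: measurableC.
    + by rewrite setUv; case/integrableP: ig.
    + exact/disj_setPCl.
  - move=> F mF tF F0; rewrite integral_bigcup//.
      by rewrite eseries0.
    apply: integrableS ig => //; exact: bigcup_measurable.
  - by rewrite -measurable_trig_approximable.
have := @integral_ae_eq _ _ _ (cube R d) setT measurableT (cst 0) (EFin \o g)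
  ig (measurable_cst _).
move=> /(_ _)/wrap[E _ mE|]; first by rewrite integral0 H.
by apply: filterS => t /(_ I)[].
Qed.

End fundamental_lemma.
End TrigonometricApproximation.

(** * Weak derivatives on the torus *)

Section WeakDerivatives.
Variables (R : realType) (d : nat).
Implicit Types (u v g psi : 'rV[R]_d -> R).

Local Notation pt := (@Defs.point R d).
Local Notation cubeR := (cube R d).
Local Notation cube_integrable f := (cubeR.-integrable setT (EFin \o f)).

Lemma L2_Lfun u : L2 u -> (fun t => u (pt t)) \in Lfun cubeR 2%:E.
Proof. by case. Qed.

Lemma L2_integrable u : L2 u -> cube_integrable (fun t => u (pt t)).
Proof.
move=> /L2_Lfun u2; apply/Lfun1_integrable.
by apply: Lfun_subset12 => //; exact: fin_num_measure.
Qed.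

Lemma integrable_mul_bounded (f h : d.-tuple R -> R) M : cube_integrable f ->
  measurable_fun setT h -> (forall t, `|h t| <= M) ->
  cube_integrable (fun t => f t * h t).
Proof.
move=> fi mh hM; have /integrableP[/measurable_EFinP mf _] := fi.
apply: (@le_integrable _ _ _ cubeR setT measurableT _
    (fun t => M%:E * (EFin \o f) t)%E).
- by apply/measurable_EFinP; exact: measurable_funM.
- move=> t _ /=; rewrite lee_fin normrM mulrC [leRHS]normrM ler_wpM2r//.
  exact: le_trans (hM t) (ler_norm _).
- exact: integrableZl.
Qed.

Lemma integrable_mul_trig (f : d.-tuple R -> R) psi : cube_integrable f ->
  trig_poly psi -> cube_integrable (fun t => f t * psi (pt t)).
Proof.
move=> fi Tpsi; have [M psiM] := trig_bounded Tpsi.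
apply: (@integrable_mul_bounded f (fun t => psi (pt t)) M) => //.
exact: measurable_trig.
Qed.

Lemma eq0_trig_orthogonal (g : d.-tuple R -> R) : cube_integrable g ->
  (forall psi, trig_poly psi -> \int[cubeR]_t (g t * psi (pt t)) = 0) ->
  {ae cubeR, forall t, g t = 0}.
Proof.
move=> gi g0; apply: trig_orthogonal_ae0 => // psi Tpsi.
have fi := integrable_mul_trig gi Tpsi.
rewrite -[LHS]fineK; last exact: integrable_fin_num fi.
by congr EFin; exact: g0.
Qed.

Lemma ae_eq_Rintegral (f h : d.-tuple R -> R) :
  measurable_fun setT f -> measurable_fun setT h ->
  {ae cubeR, forall t, f t = h t} ->
  \int[cubeR]_t f t = \int[cubeR]_t h t.
Proof.
move=> mf mh fh; congr fine; apply: ae_eq_integral => //.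
- exact/measurable_EFinP.
- exact/measurable_EFinP.
- by apply: filterS fh => t -> _.
Qed.

Lemma L2_measurable u : L2 u -> measurable_fun setT (fun t => u (pt t)).
Proof. by move=> /L2_integrable/integrableP[/measurable_EFinP]. Qed.

Lemma weak_partial_ae_unique i u v g h :
  weak_partial i u g -> weak_partial i v h ->
  {ae cubeR, forall t, u (pt t) = v (pt t)} ->
  {ae cubeR, forall t, g (pt t) = h (pt t)}.
Proof.
move=> [Lu Lg ug] [Lv Lh vh] uv.
have ig := L2_integrable Lg; have ih := L2_integrable Lh.
have : {ae cubeR, forall t, g (pt t) - h (pt t) = 0}.
  apply: (@eq0_trig_orthogonal (fun t => g (pt t) - h (pt t))).
    rewrite (_ : EFin \o _ = (EFin \o (fun t => g (pt t))) \-
      (EFin \o (fun t => h (pt t))))%E; last exact/funext.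
    exact: integrableB.
  move=> psi Tpsi; under eq_fun do rewrite mulrBl.
  rewrite RintegralB//; [|exact: integrable_mul_trig..].
  have Tp := trig_test Tpsi.
  apply/eqP; rewrite subr_eq0 -eqr_opp; apply/eqP.
  transitivity (torus_int (fun x => u x * partial i psi x)).
    by rewrite ug.
  transitivity (torus_int (fun x => v x * partial i psi x)); last by rewrite vh.
  have [_ Tdp] := trig_derive Tpsi i.
  have mdp := measurable_trig Tdp.
  apply: ae_eq_Rintegral.
  - by apply: measurable_funM mdp; exact: L2_measurable.
  - by apply: measurable_funM mdp; exact: L2_measurable.
  - by apply: filterS uv => t ->.
by apply: filterS => t /eqP; rewrite subr_eq0 => /eqP.
Qed.

Lemma RintegralZ_trig (f : d.-tuple R -> R) a psi : cube_integrable f ->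
  trig_poly psi ->
  \int[cubeR]_t (f t * (a * psi (pt t))) =
  a * \int[cubeR]_t (f t * psi (pt t)).
Proof.
move=> fi Tpsi; under eq_fun do rewrite mulrCA.
by rewrite RintegralZl//; exact: integrable_mul_trig.
Qed.

Lemma Rintegral_cube_cst (a : R) : \int[cubeR]_t (cst a t) = a.
Proof.
by rewrite Rintegral_cst//; have := probability_setT cubeR => /= ->; rewrite mulr1.
Qed.

Lemma Rintegral_wave (k : 'I_d -> int) th i : k i != 0 ->
  \int[cubeR]_t wave k th (pt t) = 0.
Proof.
move=> ki.
have i1 : cube_integrable (cst 1) by exact: finite_measure_integrable_cst.
have iw : cube_integrable (fun t => wave k th (pt t)).
  rewrite (_ : EFin \o _ = EFin \o (fun t => 1 * wave k th (pt t))).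
    by apply: (integrable_mul_trig i1); exact: trig_wave.
  by apply/funext => t /=; rewrite mul1r.
have : \int[cubeR]_t (1 + wave k th (pt t)) = 1.
  by rewrite /Rintegral (integral_wave th ki).
rewrite RintegralD// Rintegral_cube_cst.
by move=> /eqP; rewrite -subr_eq0 addrAC subrr add0r => /eqP.
Qed.

(** [u] minus its mean is orthogonal to each wave: for a nonzero frequency because
the wave is a derivative and has mean zero, for the zero frequency because the
wave is constant. *)
Lemma constant_ae_weak_gradient0 u : L2 u ->
  (forall i psi, trig_poly psi ->
    torus_int (fun x => u x * partial i psi x) = 0) ->
  constant_ae u.
Proof.
move=> Lu u0; pose c := torus_int u; exists c.
have iu := L2_integrable Lu.
have ic : cube_integrable (cst c) by exact: finite_measure_integrable_cst.
have iuc : cube_integrable (fun t => u (pt t) - c).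
  rewrite (_ : EFin \o _ = (EFin \o (fun t => u (pt t))) \-
    (EFin \o cst c))%E; last exact/funext.
  exact: integrableB.
suff : {ae cubeR, forall t, u (pt t) - c = 0}.
  by apply: filterS => t /eqP; rewrite subr_eq0 => /eqP.
apply: (@eq0_trig_orthogonal (fun t => u (pt t) - c)) => // psi.
elim=> [k th|u1 u2 T1 H1 T2 H2|a u1 T1 H1].
- have Tw := trig_wave k th.
  under eq_fun do rewrite mulrBl.
  rewrite RintegralB//; [|exact: integrable_mul_trig
                         |exact: (integrable_mul_trig ic)].
  rewrite RintegralZl//; last first.
    have i1 : cube_integrable (cst 1) by exact: finite_measure_integrable_cst.
    have := integrable_mul_trig i1 Tw.
    by under eq_fun do rewrite mul1r.
  have [[i ki]|nk] := pselect (exists i, k i != 0).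
    rewrite (Rintegral_wave _ ki) mulr0 subr0.
    (* The quarter-period shift makes the derivative a multiple of the given wave. *)
    have := u0 i _ (trig_wave k (th - pi / 2)).
    rewrite /torus_int.
    have -> : partial i (wave k (th - pi / 2)) =
        fun x => pi *+ 2 * (k i)%:~R * wave k th x.
      apply/funext => x.
      by have [_] := is_derive_wave k (th - pi / 2) i x; rewrite subrK.
    rewrite RintegralZ_trig// => /eqP; rewrite mulf_eq0 => /orP[|/eqP//].
    by rewrite mulf_eq0 intr_eq0 (negbTE ki) mulrn_eq0/= gt_eqF// pi_gt0.
  have -> : k = (fun=> 0).
    apply/funext => i; apply/eqP/negPn/negP => ki.
    by apply: nk; exists i.
  have -> : wave (fun=> 0) th = (fun=> cos th) :> ('rV[R]_d -> R).
    by apply/funext => x; exact: wave0.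
  rewrite RintegralZr// Rintegral_cube_cst.
  exact: subrr.
- under eq_fun do rewrite mulrDr.
  by rewrite RintegralD//; [rewrite H1 H2 addr0|exact: integrable_mul_trig..].
- by rewrite RintegralZ_trig// H1 mulr0.
Qed.

End WeakDerivatives.

(** * Continuous periodic functions and their ranges *)

Section ContinuousRepresentative.
Variables (R : realType) (d : nat).
Implicit Types (u w : 'rV[R]_d -> R) (x y : 'rV[R]_d).

Local Notation pt := (@Defs.point R d).

Lemma periodic_intmul u i (m : int) x :
  Defs.periodic u -> u (x + m%:~R *: unit_vec R i) = u x.
Proof.
move=> pu.
have pn n y : u (y + n%:R *: unit_vec R i) = u y.
  elim: n => [|n IH]; first by rewrite scale0r addr0.
  by rewrite -natr1 scalerDl scale1r addrA pu.
case: m => n; first by rewrite -pmulrn pn.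
rewrite NegzE mulrNz scaleNr -[in RHS](subrK (n.+1%:~R *: unit_vec R i) x).
by rewrite -pmulrn pn.
Qed.

Lemma periodic_lattice u (k : 'I_d -> int) x :
  Defs.periodic u -> u (x + \row_i (k i)%:~R) = u x.
Proof.
move=> pu; rewrite [\row_i _]row_sum_delta.
elim: (index_enum _) x => [|i s IH] x; first by rewrite big_nil addr0.
by rewrite big_cons addrA IH mxE periodic_intmul.
Qed.

(** Otherwise [w] differs from [c] at some point, which a lattice translation
brings into [0, 1[^d, and then on a box of positive measure in the unit cube. *)
Lemma continuous_ae_cst w c : Defs.periodic w -> continuous w ->
  {ae cube R d, forall t, w (pt t) = c} -> forall x, w x = c.
Proof.
move=> pw cw wc x; apply: contrapT => /eqP wx.
pose y : 'rV[R]_d := x + \row_i (- Num.floor (x 0 i))%:~R.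
have wy : w y != c by rewrite periodic_lattice.
have y01 i : 0 <= y 0 i < 1.
  have /andP[f1 f2] := floor_itv (x 0 i).
  by rewrite !mxE mulrNz subr_ge0 f1/= ltrBlDr addrC -intrD1.
move: y wy y01 => {x wx} y wy y01.
have : \forall z \near y, w z != c.
  apply: (cw y [set v | v != c]).
  by apply: open_nbhs_nbhs; split => //; exact: open_neq.
move=> /nbhs_ballP[e /= e0 ye].
pose r (i : 'I_d) : R := Num.min (y 0 i + e) 1.
pose J i : set R := `]y 0 i, r i[%classic.
have mJ i : measurable (`]y 0 i, r i[%classic : set R) by exact: measurable_itv.
have yr i : y 0 i < r i.
  by have /andP[_ y1] := y01 i; rewrite /r lt_min y1 ltrDl e0.
have : (0 < cube R d [set t | forall i, J i (tnth t i)])%E.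
  rewrite (cube_box mJ); apply: (big_ind (fun z => (0 < z)%E)) => //.
    by move=> a b; exact: mule_gt0.
  move=> i _; have /andP[y0 _] := y01 i.
  rewrite uniform01_itvoo//; first by rewrite lte_fin subr_gt0.
    exact: ltW.
  by rewrite /r ge_min lexx orbT.
case: wc => N [mN N0 wN].
suff : (cube R d [set t | forall i, J i (tnth t i)] <= cube R d N)%E.
  by rewrite N0 => /le_lt_trans /[apply]; rewrite ltxx.
apply: le_measure; rewrite ?inE//; first exact: measurable_box.
move=> t Jt; apply: wN => /= wt.
have : w (pt t) != c.
  apply: ye; split => // i j; rewrite (ord1 i) mxE.
  have := Jt j; rewrite /J /= in_itv/= /r lt_min => /andP[yt /andP[te _]].
  by rewrite /ball/= ltr_distlC; apply/andP; split; lra.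
by rewrite wt eqxx.
Qed.

Lemma segment_in_range w x y a : continuous w -> 0 <= a <= 1 ->
  exists z, w z = w x + a * (w y - w x).
Proof.
move=> cw /andP[a0 a1].
pose p (h : R) := w (x + h *: (y - x)).
have cp : continuous p.
  move=> h; apply: continuous_comp; last exact: cw.
  apply: continuousD; first exact: cst_continuous.
  by apply: cvgZr_tmp; exact: cvg_id.
have p0 : p 0 = w x by rewrite /p scale0r addr0.
have p1 : p 1 = w y by rewrite /p scale1r addrC subrK.
have [] := @IVT R p 0 1 (w x + a * (w y - w x)) ler01.
- exact: continuous_subspaceT.
- rewrite p0 p1 ge_min le_max.
  by case: (leP (w x) (w y)) => xy; apply/andP; split; apply/orP;
    [left|right|right|left]; nra.
- by move=> h _ ph; exists (x + h *: (y - x)).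
Qed.

End ContinuousRepresentative.

(** The difference quotients along s + (s' - s) / (n + 1) are all zero.  The segment
may lie on one side of [s] only, as happens when [s] is an extreme value. *)
Lemma derive1_eq0_segment (R : realType) (h : R -> R) (s s' : R) :
  s != s' -> derivable h s 1 ->
  (forall a, 0 <= a <= 1 -> h (s + a * (s' - s)) = h s) -> h^`() s = 0.
Proof.
move=> ss' dh hs.
have ds : s' - s != 0 by rewrite subr_eq0 eq_sym.
have D : (fun e => e^-1 *: ((h \o shift s) (e *: (1 : R)) - h s)) @ 0^'
    --> h^`() s by rewrite derive1E.
pose e n : R := n.+1%:R^-1 * (s' - s).
have e0 : e n @[n --> \oo] --> 0.
  rewrite -(mul0r (s' - s)); apply: cvgM; last exact: cvg_cst.
  exact: cvg_harmonic.
have := (cvgr_dnbhsP _ _ _).1 D e.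
move=> /(_ _)/wrap[|De].
  by split => // n; rewrite mulf_neq0// invr_neq0.
apply: (cvg_unique _ De) => //.
have -> : (fun n => (e n)^-1 *: ((h \o shift s) (e n *: (1 : R)) - h s)) =
    (fun=> 0).
  apply/funext => n /=; rewrite [_%:A]mulr1 [e n + s]addrC hs ?subrr ?scaler0//.
  by rewrite invr_ge0 ler0n/= invf_le1// ler1n.
exact: cvg_cst.
Qed.

(** * Equilibria of the Cahn-Hilliard system *)

Section Equilibria.
Variables (R : realType) (d : nat).
Implicit Types (b f : R -> R) (phi mu : 'rV[R]_d -> R).

Local Notation pt := (@Defs.point R d).

(** Uniqueness of weak partial derivatives, first for the gradient and then for
its components. *)
Lemma weak_laplacian_ae_unique phi L L' :
  weak_laplacian phi L -> weak_laplacian phi L' ->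
  {ae cube R d, forall t, L (pt t) = L' (pt t)}.
Proof.
move=> [G pG [D GD LE]] [G' pG' [D' GD' LE']].
have DD' i : {ae cube R d, forall t, D i (pt t) = D' i (pt t)}.
  apply: (weak_partial_ae_unique (GD i) (GD' i)).
  by apply: (weak_partial_ae_unique (pG i) (pG' i)); exact: aeW.
have : {ae cube R d, forall t i, D i (pt t) = D' i (pt t)}.
  exact: filter_forall.
by apply: filterS => t DDt; rewrite LE LE'; apply: eq_bigr => i _.
Qed.

Lemma derivable_continuous_R (h : R -> R) :
  (forall s, derivable h s 1) -> continuous h.
Proof.
by move=> dh s; apply/differentiable_continuous/derivable1_diffP.
Qed.

Lemma mobility_continuous b : mobility b -> continuous b.
Proof.
move=> [[db _] _]; apply: derivable_continuous_R => s.
by have := db 0%N isT s; rewrite derive1n0.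
Qed.

Lemma potential_derivative_derivable f :
  potential_derivative f -> forall s, derivable f s 1.
Proof.
move=> [F [[dF _] -> _ _]] s.
by have := dF 1%N isT s; rewrite derive1n1.
Qed.

(** Energy identity: with mu as its own test function, the equation says that the
nonnegative function b(phi) |grad mu|^2 has integral zero. *)
Lemma weak_div_grad_constant_ae b phi mu : mobility b -> L2 phi ->
  sobolev 1 mu -> weak_div_grad_eq0 (b \o phi) mu -> constant_ae mu.
Proof.
move=> mb Lphi Smu [G muG div0].
have LG i : L2 (G i) by have [] := muG i.
have Lmu : L2 mu by have [] := Smu.
have [_ [b1 [b2 [_ [_ [b1_gt0 bb _ _]]]]]] := mb.
have cb := mobility_continuous mb.
have {div0} := div0 mu G Smu muG.
rewrite /torus_int.
pose q t := \sum_(i < d) G i (pt t) * G i (pt t).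
have q0 t : 0 <= q t by apply: sumr_ge0 => i _; rewrite -expr2 sqr_ge0.
have iq : (cube R d).-integrable setT (EFin \o q).
  rewrite (_ : EFin \o q = fun t =>
      (\sum_(i <- index_enum 'I_d) (G i (pt t) * G i (pt t))%:E)%E); last first.
    by apply/funext => t; rewrite sumEFin.
  apply: integrable_sum => // i _.
  by apply/Lfun1_integrable; apply: Lfun2_mul_Lfun1; exact: L2_Lfun.
have mbphi : measurable_fun setT (fun t => b (phi (pt t))).
  apply: (measurableT_comp (f := b)); last exact: L2_measurable.
  exact: continuous_measurable_fun.
have ibq : (cube R d).-integrable setT (EFin \o (fun t => q t * b (phi (pt t)))).
  apply: (@integrable_mul_bounded _ _ q (fun t => b (phi (pt t))) b2) => // t.
  have /andP[bl bu] := bb (phi (pt t)).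
  by rewrite ger0_norm// (le_trans _ bl)// ltW.
have bq0 t : 0 <= q t * b (phi (pt t)).
  have /andP[bl _] := bb (phi (pt t)).
  by rewrite mulr_ge0// (le_trans _ bl)// ltW.
under eq_Rintegral do rewrite mulrC.
move=> int0.
have /integrableP[mbq _] := ibq.
have : ae_eq (cube R d) setT (EFin \o (fun t => q t * b (phi (pt t)))) (cst 0%E).
  apply/ae_eq_integral_abs => //.
  under eq_integral => t _ do rewrite gee0_abs ?lee_fin//.
  rewrite -[LHS]fineK; last exact: integrable_fin_num.
  by congr EFin; exact: int0.
move=> bq_ae.
have G0 i : {ae cube R d, forall t, G i (pt t) = 0}.
  apply: filterS bq_ae => t /(_ I)/= [/eqP].
  have /andP[bl _] := bb (phi (pt t)).
  rewrite mulf_eq0 [X in _ || X]gt_eqF ?orbF ?(lt_le_trans _ bl)//.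
  rewrite psumr_eq0; last by move=> j _; rewrite -expr2 sqr_ge0.
  move=> /allP/(_ i); rewrite mem_index_enum => /(_ isT).
  by rewrite mulf_eq0 orbb => /eqP.
apply: constant_ae_weak_gradient0 => // i psi Tpsi.
have [_ _ ->] := muG i; last exact: trig_test.
rewrite -[RHS]oppr0; congr (- _).
rewrite -[RHS](Rintegral_cube_cst d 0); apply: ae_eq_Rintegral => //.
  by apply: measurable_funM; [exact: L2_measurable|exact: measurable_trig].
by apply: filterS (G0 i) => t ->; rewrite mul0r.
Qed.

End Equilibria.

Theorem theorem7 (R : realType) (d : nat) (hd : (1 <= d <= 3)%N)
  (gamma : R) (hgamma : 0 < gamma)
  (b1 b2 : R -> R) (hb1 : mobility b1) (hb2 : mobility b2)
  (f1 f2 : R -> R)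
  (hf1 : potential_derivative f1) (hf2 : potential_derivative f2)
  (phi mu1 mu2 : 'rV[R]_d -> R)
  (heq1 : equilibrium b1 f1 gamma phi mu1)
  (heq2 : equilibrium b2 f2 gamma phi mu2)
  (hphi : ~ constant_ae phi) :
  forall s, value_set phi s -> f1^`() s = f2^`() s.
Proof.
move=> s [psi [ppsi cpsi psiphi [x0 _ psix0]]].
have [Sphi Smu1 div1 [L1 phiL1 mu1E]] := heq1.
have [_ Smu2 div2 [L2 phiL2 mu2E]] := heq2.
have Lphi : Defs.L2 phi by have [] := Sphi.
have [c1 mu1c] := weak_div_grad_constant_ae hb1 Lphi Smu1 div1.
have [c2 mu2c] := weak_div_grad_constant_ae hb2 Lphi Smu2 div2.
have df1 := potential_derivative_derivable hf1.
have df2 := potential_derivative_derivable hf2.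
pose h := f1 - f2.
have dh v : derivable h v 1 by exact: derivableB.
have hpsi x : h (psi x) = c1 - c2.
  apply: (@continuous_ae_cst R d (h \o psi)).
  - by move=> i y; rewrite /= ppsi.
  - move=> y; apply: continuous_comp; first exact: cpsi.
    exact: derivable_continuous_R.
  - have LL := weak_laplacian_ae_unique phiL1 phiL2.
    near=> t; have <- : mu1 (Defs.point t) = c1 by near: t.
    have <- : mu2 (Defs.point t) = c2 by near: t.
    have -> : mu1 (Defs.point t) = - gamma * L1 (Defs.point t) +
      f1 (phi (Defs.point t)) by near: t.
    have -> : mu2 (Defs.point t) = - gamma * L2 (Defs.point t) +
      f2 (phi (Defs.point t)) by near: t.
    have -> : L1 (Defs.point t) = L2 (Defs.point t) by near: t.
    rewrite /= (_ : psi (Defs.point t) = phi (Defs.point t)); last by near: t.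
    by rewrite opprD addrACA subrr add0r.
have [x1 psix1] : exists x1, psi x1 != s.
  apply: contrapT => nx1; apply: hphi; exists s.
  apply: filterS psiphi => t <-; apply/eqP/negPn/negP => ?.
  by apply: nx1; exists (Defs.point t).
have : h^`() s = 0.
  apply: (@derive1_eq0_segment _ h s (psi x1)) => //; first by rewrite eq_sym.
  move=> a a01; rewrite -psix0.
  by have [z <-] := segment_in_range x0 x1 cpsi a01; rewrite !hpsi.
by rewrite derive1E deriveB// -!derive1E => /eqP; rewrite subr_eq0 => /eqP.
Unshelve. all: by end_near.
Qed.
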